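(* Let $n \ge 1$, and let $\leq$ denote the strong Bruhat order on $S_n$. (a) For $v, w \in S_n$, if $v \leq w$ then $\mathcal{P}_w \subseteq \mathcal{P}_v$. (b) The sets $\mathcal{Q}_w := \mathcal{P}_w \setminus \bigcup_{v > w} \mathcal{P}_v$, for $w \in S_n$, are pairwise disjoint. (c) If $w \in S_n$ contains the pattern $123$, then $\mathcal{Q}_w$ is empty. (d) If $w \in S_n$ avoids $123$, let $A_1, \ldots, A_k$ be the maximal intervals in the set of anti-fixed points of $w$. Then $$\mathcal{Q}_w = \bigoplus_{i=1}^k \mathcal{P}_{A_i, n} \oplus \{w(L(w))\} \oplus \{n + R(w)\}.$$
   Context: For integers $a \le b$, $[a,b] = \{a, \ldots, b\}$ and $[n]=[1,n]$. For $w \in S_n$, let $M_w$ be a generic $n \times 2n$ matrix whose nonzero entries in row $i$ are exactly in columns $[w(i), i+n]$ (generic: the nonzero entries are algebraically independent). $\mathcal{P}_w$ is the set of $n$-subsets $I$ of $[2n]$ such that the minor of $M_w$ in rows $[n]$ and columns $I$ is nonzero. Equivalently, $\mathcal{P}_w$ is the set of transversals of the set collection $([w(i), i+n])_{1 \le i \le n}$. A permutation contains $123$ if it has a (not necessarily consecutive) increasing subsequence of length $3$, and avoids $123$ otherwise. An anti-fixed point of $w \in S_n$ is $i \in [n]$ with $w(i) = n-i+1$. A left-to-right minimum of $w$ is a position $i \in [n]$ such that $j < i$ implies $w(i) < w(j)$; a right-to-left maximum is a position $i$ such that $j > i$ implies $w(i) > w(j)$. $L(w)$ is the set of left-to-right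 minima of $w$ that are not right-to-left maxima; $R(w)$ is the set of right-to-left maxima that are not left-to-right minima. For a set $A$ of integers, $n + A = \{n+i : i \in A\}$. Write $\mathcal{P}_k$ for $\mathcal{P}_{w_0}$ where $w_0 = k(k-1)\cdots 21 \in S_k$. For a nonempty interval $K = \{x_1 < \cdots < x_k\} \subseteq [n]$, let $Z(K) = \{n-x_k+1, \ldots, n-x_1+1, n+x_1, \ldots, n+x_k\}$, let $f_{K,n} : [2k] \to Z(K)$ be the unique increasing bijection, and let $\mathcal{P}_{K,n} = f_{K,n}(\mathcal{P}_k) = \{f_{K,n}(I) : I \in \mathcal{P}_k\}$. For families of sets $\mathcal{F}, \mathcal{G}$, $\mathcal{F} \oplus \mathcal{G} = \{I \sqcup J : I \in \mathcal{F}, J \in \mathcal{G}\}$. *)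

(* Defs.v *)
From mathcomp Require Import all_boot all_order all_fingroup all_algebra.
From mathcomp Require Import mpoly.

Set Implicit Arguments.
Unset Strict Implicit.
Unset Printing Implicit Defensive.

(* Everything is 0-based: i : 'I_n is the element i + 1 of [n], and
   c : 'I_(n + n) is the element c + 1 of [2n].  Hence lshift n c is the
   element c + 1 of [2n], and rshift n i is n + (i + 1).  A permutation w
   sends the position i + 1 to the value (w i) + 1. *)

(* Strong Bruhat order: the reflexive transitive closure of u < u t for t a
   transposition that increases the length (the number of inversions).
   Products in 'S_n are composed left to right, so tperm i j * u is u o (i j). *)
Definition inversions n (w : 'S_n) : {set 'I_n * 'I_n} :=
  [set p : 'I_n * 'I_n | (p.1 < p.2) && (w p.2 < w p.1)].

Definition bruhat_step n (u v : 'S_n) : bool :=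
  [exists i : 'I_n, exists j : 'I_n, v == (tperm i j * u)%g]
  && (#|inversions u| < #|inversions v|).

Definition bruhat_le n (u v : 'S_n) : bool := connect (@bruhat_step n) u v.

Definition bruhat_lt n (u v : 'S_n) : bool := bruhat_le u v && (u != v).

(* The entries allowed to be nonzero are distinct indeterminates over the
   rationals; in 1-based terms they are those in columns [w(i), i + n]. *)
Definition generic_mx n (w : 'S_n) : 'M[{mpoly rat[n * (n + n)]}]_(n, n + n) :=
  (\matrix_(i, j) if (w i <= j <= i + n)%N then 'X_(mxvec_index i j) else 0)%R.

(* Meaningful only when #|I| = n: the default of nth is then never used, and
   the columns are listed in increasing order. *)
Definition minor n (R : comNzRingType) (M : 'M[R]_(n, n + n))
    (I : {set 'I_(n + n)}) : R :=
  (\det (colsub (fun j : 'I_n => nth (lshift n j) (enum I) j) M))%R.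

Definition calP n (w : 'S_n) : {set {set 'I_(n + n)}} :=
  [set I : {set 'I_(n + n)} | (#|I| == n) && (minor (generic_mx w) I != 0%R)].

Definition calQ n (w : 'S_n) : {set {set 'I_(n + n)}} :=
  calP w :\: \bigcup_(v | bruhat_lt w v) calP v.

Definition contains123 n (w : 'S_n) : bool :=
  [exists i : 'I_n, exists j : 'I_n, exists k : 'I_n,
    [&& i < j, j < k, w i < w j & w j < w k]].

(* The value n - (i + 1) + 1 is rev_ord i in 0-based terms. *)
Definition antifixed n (w : 'S_n) : {set 'I_n} := [set i : 'I_n | w i == rev_ord i].

Definition lr_minima n (w : 'S_n) : {set 'I_n} :=
  [set i : 'I_n | [forall j : 'I_n, (j < i) ==> (w i < w j)]].

Definition rl_maxima n (w : 'S_n) : {set 'I_n} :=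
  [set i : 'I_n | [forall j : 'I_n, (i < j) ==> (w j < w i)]].

Definition Lset n (w : 'S_n) : {set 'I_n} := lr_minima w :\: rl_maxima w.

Definition Rset n (w : 'S_n) : {set 'I_n} := rl_maxima w :\: lr_minima w.

Definition is_interval n (A : {set 'I_n}) : bool :=
  [exists a : 'I_n, exists b : 'I_n,
    (a <= b) && (A == [set x : 'I_n | a <= x <= b])].

Definition max_intervals n (S : {set 'I_n}) : {set {set 'I_n}} :=
  [set A | maxset (fun B : {set 'I_n} => is_interval B && (B \subset S)) A].

Definition w0 k : 'S_k := perm (@rev_ord_inj k).

(* In 1-based terms, {n - x + 1 | x in K} together with {n + x | x in K}. *)
Definition Zset n (K : {set 'I_n}) : {set 'I_(n + n)} :=
  [set lshift n (rev_ord x) | x in K] :|: [set rshift n x | x in K].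

Lemma card_Zset n (K : {set 'I_n}) : #|Zset K| = #|K| + #|K|.
Proof.
rewrite cardsU disjoint_setI0 ?cards0 ?subn0.
  rewrite !card_imset //; first exact: rshift_inj.
  by move=> x y /lshift_inj /rev_ord_inj.
rewrite disjoints_subset; apply/subsetP => _ /imsetP [x _ ->].
rewrite inE; apply/imsetP => -[y _ /eqP].
by rewrite eq_lrshift.
Qed.

Definition fK n (K : {set 'I_n}) (i : 'I_(#|K| + #|K|)) : 'I_(n + n) :=
  enum_val (cast_ord (esym (card_Zset K)) i).

Lemma fK_increasing n (K : {set 'I_n}) (i j : 'I_(#|K| + #|K|)) :
  i < j -> fK i < fK j.
Proof.
move=> lt_ij; have x0 : 'I_(n + n) := fK i.
have sz : size (enum (Zset K)) = #|K| + #|K| by rewrite -cardE card_Zset.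
have srt : sorted ltn (map val (enum (Zset K))).
  rewrite {1}/enum_mem -enumT.
  apply: (subseq_sorted ltn_trans (map_subseq val (filter_subseq _ _))).
  by rewrite val_enum_ord iota_ltn_sorted.
rewrite /fK !(enum_val_nth x0) /= -!(nth_map x0 0) ?sz //.
by apply: (sorted_ltn_nth ltn_trans); rewrite ?inE ?size_map ?sz.
Qed.

Lemma fK_image n (K : {set 'I_n}) : [set fK i | i : 'I_(#|K| + #|K|)] = Zset K.
Proof.
apply/setP => c; apply/imsetP/idP => [[i _ ->]|cZ]; first exact: enum_valP.
exists (cast_ord (card_Zset K) (enum_rank_in cZ c)) => //.
by rewrite /fK cast_ordK enum_rankK_in.
Qed.

Definition calPK n (K : {set 'I_n}) : {set {set 'I_(n + n)}} :=
  [set [set fK i | i in I] | I : {set 'I_(#|K| + #|K|)} in calP (w0 #|K|)].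

(* The sum of two families is the set of all unions.  That these unions are
   disjoint is a separate property, disjoint_families below. *)
Definition oplus (T : finType) (F G : {set {set T}}) : {set {set T}} :=
  [set I :|: J | I in F, J in G].

Notation "F \oplus G" := (oplus F G) (at level 50, left associativity).

Notation "\bigoplus_ ( i 'in' S ) F" :=
  (\big[@oplus _/[set set0]]_(i in S) F)
  (at level 36, F at level 36, i at level 50,
   format "\bigoplus_ ( i  'in'  S )  F").

Definition disjoint_families (T : finType) (s : seq {set {set T}}) : bool :=
  pairwise (fun F G : {set {set T}} =>
    [forall I in F, forall J in G, [disjoint (I : {set T}) & (J : {set T})]]) s.

(* Main.v *)
(** Encode an [n]-subset [I] of [2n] by the set [B] of the [b] with [n + b] in [I]
    and the set [A] of the [a] whose mirror image [n + 1 - a] is in [I], write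
    [p(x)], [q(y)] for the number of elements of [B], [A] among the first [x], [y]
    integers, and replace [w] by [u = w w0], with rank function
    [r_u(x, y) = #{i <= x : u(i) <= y}].  By Hall's theorem [I] is a transversal for
    [w] iff [r_u(x, y) <= p(x) + q(y)] for all [x], [y], so the tableau criterion for
    the Bruhat order gives (a).  The function [min(x, y, p(x) + q(y))] has mixed
    differences 0 and 1, hence is the rank function of a permutation: the largest one
    having [I] as a transversal.  So [I] lies in [Q_w] iff [r_u] equals that function,
    which gives (b).  At an entry [(i, u(i))] the minimum is one of the first two
    terms, so [i] is a left-to-right maximum or a right-to-left minimum of [u], which
    gives (c).  For (d), one reads off the equality that a non-fixed [i] of [u] is in
    [B] iff [u(i) < i] and in [A] iff [u^-1(i) < i], and that [p(m) + q(m) - m] is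
    nonnegative on each maximal interval of fixed points and vanishes at its ends;
    conversely these conditions determine [p(x) + q(y) - r_u(x, y)]. *)
Require Import Defs.
From mathcomp Require Import all_boot all_order all_fingroup all_algebra.
From mathcomp Require Import mpoly zify.

Set Implicit Arguments.
Unset Strict Implicit.
Unset Printing Implicit Defensive.

(** * Hall's theorem and rank functions of permutations *)

(** Induction on the size of [A]: if some proper nonempty subset is tight, match it first and the
    rest outside its neighbourhood; otherwise match one element arbitrarily. The map [d] provides
    values when [A] is empty. *)
Lemma hall (X Y : finType) (e : X -> Y -> bool) (d : X -> Y) (A : {set X}) :
  (forall S : {set X}, S \subset A ->
     #|S| <= #|[set y | [exists x in S, e x y]]|) ->
  exists2 f : X -> Y, {in A &, injective f} & {in A, forall x, e x (f x)}.
Proof.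
have [k] := ubnP #|A|; elim: k e A => // k IHk e A ltAk hallA.
have [A0 | [x0 x0A]] := set_0Vmem A.
  by exists d; rewrite A0 => x; rewrite inE.
pose N (S : {set X}) := [set y | [exists x in S, e x y]].
have [/existsP [S /and4P [S0 SA SnA tight]] | notight] :=
  boolP [exists S : {set X}, [&& S != set0, S \subset A, S != A & #|N S| == #|S|]].
- have SpA : #|S| < #|A| by apply: proper_card; rewrite properEneq SnA.
  have [| f injf ef] := IHk e S (leq_trans SpA ltAk).
    by move=> T TS; apply: hallA; apply: subset_trans SA.
  have cAS : #|A :\: S| < k.
    rewrite cardsDS //; move: S0; rewrite -card_gt0; lia.
  (* Hall's condition survives outside [N S]: [T :|: S] has at least |T| + |S| neighbours, and only
     |S| of them lie in [N S]. *)
  have [T TAS | g injg eg] := IHk (fun x y => e x y && (y \notin N S)) _ cAS.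
    have := hallA (T :|: S).
    rewrite subUset SA (subset_trans TAS (subsetDl _ _)) => /(_ isT).
    rewrite cardsU (_ : T :&: S = set0) ?cards0; last first.
      by apply/eqP; rewrite setI_eq0; move: TAS; rewrite subsetD => /andP [].
    suff : #|N (T :|: S)| <= #|N S| + #|[set y | [exists x in T, e x y && (y \notin N S)]]|.
      by rewrite /N (eqP tight); lia.
    apply: leq_trans (leq_card_setU _ _); apply: subset_leq_card.
    apply/subsetP => y; rewrite !inE => /existsP [x /andP [/setUP [xT|xS] exy]].
      2: by apply/orP; left; apply/existsP; exists x; rewrite xS.
    have [//|yS] := boolP [exists x in S, e x y]; apply/existsP; exists x.
    by rewrite xT exy.
  exists (fun x => if x \in S then f x else g x).
    move=> x x' xA x'A /=; case: ifP => xS; case: ifP => x'S.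
    + exact: injf.
    + move=> fg; have /andP [_ /negP []] : e x' (g x') && (g x' \notin N S).
        by apply: eg; rewrite inE x'S.
      by rewrite -fg inE; apply/existsP; exists x; rewrite xS ef.
    + move=> fg; have /andP [_ /negP []] : e x (g x) && (g x \notin N S).
        by apply: eg; rewrite inE xS.
      by rewrite fg inE; apply/existsP; exists x'; rewrite x'S ef.
    + by apply: injg; rewrite inE ?xS ?x'S.
  move=> x xA /=; case: ifP => xS; first exact: ef.
  by have /andP [] : e x (g x) && (g x \notin N S) by apply: eg; rewrite inE xS.
- have [y exy] : exists y, e x0 y.
    have := hallA [set x0]; rewrite sub1set x0A cards1 => /(_ isT) /card_gt0P [y].
    by rewrite inE => /existsP [x /andP [/set1P -> exy]]; exists y.
  have cA : #|A :\ x0| < k by move: ltAk; rewrite (cardsD1 x0) x0A; lia.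
  (* In the absence of tight subsets, each proper nonempty [T] has a spare neighbour, which makes up
     for the loss of [y]. *)
  have [T TA | g injg eg] := IHk (fun x z => e x z && (z != y)) _ cA.
    have [->|T0] := eqVneq T set0; first by rewrite cards0.
    have TsA : T \subset A by apply: subset_trans TA (subsetDl _ _).
    have TnA : T != A by apply: contraTneq TA => ->; apply/subsetPn; exists x0; rewrite ?inE ?eqxx.
    move/existsPn: notight => /(_ T); rewrite T0 TsA TnA /= => nt.
    have := hallA _ TsA; rewrite -/(N T) => le.
    have lt : #|T| < #|N T| by rewrite ltn_neqAle eq_sym nt.
    suff : #|N T| <= #|[set y] :|: [set z | [exists x in T, e x z && (z != y)]]|.
      by rewrite cardsU cards1; lia.
    apply: subset_leq_card; apply/subsetP => z; rewrite !inE => /existsP [x /andP [xT exz]].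
    by have [//|zy /=] := eqVneq z y; apply/existsP; exists x; rewrite xT exz.
  exists (fun x => if x == x0 then y else g x).
    have gy x : x \in A -> x != x0 -> g x != y.
      by move=> xA xx0; have /andP [] : e x (g x) && (g x != y) by apply: eg; rewrite !inE xx0.
    move=> x x' xA x'A /=; case: eqVneq => [->|xx0]; case: eqVneq => [->//|x'x0].
    + by move=> yg; have := gy x' x'A x'x0; rewrite yg eqxx.
    + by move=> yg; have := gy x xA xx0; rewrite yg eqxx.
    + by apply: injg; rewrite !inE ?xx0 ?x'x0.
  move=> x xA /=; case: eqVneq => [->//|xx0].
  by have /andP [] : e x (g x) && (g x != y) by apply: eg; rewrite !inE xx0.
Qed.

(** * Counting functions and rank functions *)

Definition cnt n (S : {set 'I_n}) (x : nat) : nat := #|[set i in S | i < x]|.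

Section Counting.
Variables (n : nat) (S : {set 'I_n}).

Lemma cnt0 : cnt S 0 = 0.
Proof. by apply/eqP; rewrite cards_eq0; apply/eqP/setP => i; rewrite !inE andbF. Qed.

Lemma cnt_full : cnt S n = #|S|.
Proof. by apply: eq_card => i; rewrite !inE ltn_ord andbT. Qed.

Lemma cntS (i : 'I_n) : cnt S i.+1 = cnt S i + (i \in S).
Proof.
rewrite /cnt (cardsD1 i) !inE ltnSn andbT addnC; congr (_ + _).
apply: eq_card => j; rewrite !inE ltnS leq_eqVlt.
by have [->|] := eqVneq j i; rewrite ?ltnn ?andbF // => /negPf; rewrite -val_eqE /= => ->.
Qed.

Lemma leq_cnt x y : x <= y -> cnt S x <= cnt S y.
Proof.
move=> le; apply: subset_leq_card; apply/subsetP => i; rewrite !inE.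
by case/andP=> -> /leq_trans ->.
Qed.

Lemma cntS_nat x : x < n -> exists b : bool, cnt S x.+1 = cnt S x + b.
Proof. by move=> lt; exists (Ordinal lt \in S); rewrite -(cntS (Ordinal lt)). Qed.

Lemma cnt_leq x : x <= n -> cnt S x <= x.
Proof.
elim: x => [|x IHx] lt; first by rewrite cnt0.
by have [b ->] := cntS_nat lt; move: (IHx (ltnW lt)); case: b; lia.
Qed.

Lemma cntD x d : x + d <= n -> cnt S (x + d) <= cnt S x + d.
Proof.
elim: d => [|d IHd] led; first by rewrite !addn0.
rewrite addnS; have [b ->] := cntS_nat (x:=x+d) ltac:(lia).
by have := IHd ltac:(lia); case: b; lia.
Qed.

Lemma card_leq_cnt x : x <= n -> #|S| <= cnt S x + (n - x).
Proof.
by move=> le; rewrite -cnt_full; have := @cntD x (n - x); rewrite subnKC // => ->.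
Qed.

End Counting.

Definition rk n (u : 'S_n) (x y : nat) : nat := cnt [set i | u i < y] x.

Section Ranks.
Variable n : nat.
Implicit Types u v : 'S_n.

Lemma rk0 u y : rk u 0 y = 0.
Proof. exact: cnt0. Qed.

Lemma rkSl u (i : 'I_n) y : rk u i.+1 y = rk u i y + (u i < y).
Proof. by rewrite /rk cntS inE. Qed.

Lemma rkV u x y : rk u x y = rk u^-1 y x.
Proof.
rewrite /rk /cnt -(card_imset _ (@perm_inj _ u)); apply: eq_card => j.
rewrite !inE; apply/imsetP/andP => [[i + ->]|[lt1 lt2]]; first by rewrite !inE permK => /andP [].
by exists (u^-1 j)%g; rewrite ?inE ?permKV // lt1 lt2.
Qed.

Lemma rkSr u (i : 'I_n) x : rk u x (u i).+1 = rk u x (u i) + (i < x).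
Proof. by rewrite !(rkV u) rkSl permK. Qed.

Lemma rkS_nat u x (j : 'I_n) : rk u x j.+1 = rk u x j + (u^-1 j < x)%g.
Proof. by rewrite !(rkV u) rkSl. Qed.

Lemma rk_leql u x y : x <= n -> rk u x y <= x.
Proof. exact: cnt_leq. Qed.

Lemma rk_leqr u x y : y <= n -> rk u x y <= y.
Proof. by rewrite rkV; exact: cnt_leq. Qed.

Lemma rk_fulll u y : y <= n -> rk u n y = y.
Proof.
rewrite rkV /rk; elim: y => [|y IHy] lt; first by rewrite cnt0.
by rewrite (cntS _ (Ordinal lt)) /= IHy ?inE ?ltn_ord ?addn1 // ltnW.
Qed.

Lemma rk_eql u x y : x <= n -> (forall i : 'I_n, i < x -> u i < y) -> rk u x y = x.
Proof.
elim: x => [|x IHx] lt lty; first by rewrite rk0.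
rewrite (rkSl _ (Ordinal lt)) /= IHx ?(ltnW lt) //; last by move=> i /ltnW /lty.
by rewrite lty // addn1.
Qed.

Lemma rk_eqr u x y : y <= n -> (forall i : 'I_n, u i < y -> i < x) -> rk u x y = y.
Proof.
move=> ley lt; rewrite rkV rk_eql // => j ltj.
by apply: lt; rewrite permKV.
Qed.

Lemma rk_ltl u (i : 'I_n) x y : i < x -> x <= n -> y <= u i -> rk u x y < x.
Proof.
move=> ix lex yu; have := @cntD _ [set i | u i < y] i.+1 (x - i.+1).
rewrite subnKC // -!/(rk _ _ _) rkSl => /(_ lex).
have := @rk_leql u i y (ltnW (ltn_ord i)); lia.
Qed.

Lemma rk_ltr u (i : 'I_n) x y : x <= i -> u i < y -> y <= n -> rk u x y < y.
Proof. by move=> xi uy ley; rewrite rkV (rk_ltl uy) // permK. Qed.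

Lemma rk_inj u v :
  (forall x y, x <= n -> y <= n -> rk u x y = rk v x y) -> u = v.
Proof.
move=> eq_rk; apply/permP => i; apply/val_inj/eqP; rewrite eqn_leq.
have E y : y <= n -> (u i < y) = (v i < y) :> nat.
  move=> le; apply: (@addnI (rk u i y)).
  by rewrite -rkSl eq_rk // rkSl eq_rk // ltnW.
move: (E (v i).+1 (ltn_ord _)) (E (u i).+1 (ltn_ord _)) => /=; lia.
Qed.

(** The mixed differences of [g] form a matrix of nonnegative integers, and the boundary values make
    all row and column sums 1, so it is a permutation matrix. *)
Lemma perm_of_rank (g : nat -> nat -> nat) :
    (forall y, y <= n -> g 0 y = 0) -> (forall x, x <= n -> g x 0 = 0) ->
    (forall y, y <= n -> g n y = y) -> (forall x, x <= n -> g x n = x) ->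
    (forall x y, x < n -> y < n -> g x.+1 y + g x y.+1 <= g x y + g x.+1 y.+1) ->
  exists u, forall x y, x <= n -> y <= n -> rk u x y = g x y.
Proof.
move=> g0l g0r gnl gnr super.
have monoy x y d : x < n -> y + d <= n ->
    g x.+1 y + g x (y + d) <= g x y + g x.+1 (y + d).
  move=> lx; elim: d => [|d IHd] led; first by rewrite addn0 addnC.
  by rewrite addnS; have := super x (y + d) lx ltac:(lia); have := IHd ltac:(lia); lia.
have monox x y d : y < n -> x + d <= n ->
    g x y.+1 + g (x + d) y <= g x y + g (x + d) y.+1.
  move=> ly; elim: d => [|d IHd] led; first by rewrite addn0 addnC.
  by rewrite addnS; have := super (x + d) y ltac:(lia) ly; have := IHd ltac:(lia); lia.
(* The 1 in row [i] sits just below the least [y] with [g i y < g i.+1 y]; the row sum leaves room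
   for no other. *)
have jump (i : 'I_n) : exists y : 'I_n, forall z, z <= n -> g i.+1 z = g i z + (y < z).
  have lei := ltn_ord i.
  have exm : exists y, (y <= n) && (g i y < g i.+1 y).
    by exists n; rewrite leqnn !gnr //; lia.
  case: (ex_minnP exm) => -[|m] /andP [lem gm] minm.
    by move: gm; rewrite !g0r //; lia.
  exists (Ordinal lem) => z lez /=.
  have := monoy i 0 z lei ltac:(lia); have := monoy i z (n - z) lei ltac:(lia).
  rewrite add0n !g0r ?subnKC ?gnr //; try lia.
  case: (ltnP m z) => mz.
    have := monoy i m.+1 (z - m.+1) lei ltac:(lia); rewrite subnKC //; lia.
  move=> _ _; have: ~~ (g i z < g i.+1 z) by apply/negP => gz; have := minm z; rewrite lez gz; lia.
  by have := monoy i 0 z lei ltac:(lia); rewrite add0n !g0r //; lia.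
have [f fP] := fin_all_exists jump.
have f_inj : injective f.
  suff W (i j : 'I_n) : i < j -> f i = f j -> False.
    move=> i j fij; apply: val_inj => /=; case: (ltngtP i j) => //.
      by move=> /W /(_ fij).
    by move=> /W /(_ (esym fij)).
  (* Two rows with their 1 in the same column would make that column sum at least 2. *)
  move=> ij fij; have ly := ltn_ord (f i); have lj := ltn_ord j.
  have e1 := fP i (f i) ltac:(lia); have e2 := fP i (f i).+1 ltac:(lia).
  have e3 := fP j (f i) ltac:(lia); have e4 := fP j (f i).+1 ltac:(lia).
  rewrite -fij ltnn ltnSn in e1 e2 e3 e4.
  have := monox 0 (f i) i ly ltac:(lia); rewrite add0n !g0l; try lia.
  have := monox i.+1 (f i) (j - i.+1) ly ltac:(lia); rewrite subnKC //.
  have := monox j.+1 (f i) (n - j.+1) ly ltac:(lia); rewrite subnKC // !gnl; lia.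
exists (perm f_inj) => x y lex ley; elim: x lex => [|x IHx] lt; first by rewrite rk0 g0l.
by rewrite (rkSl _ (Ordinal lt)) permE /= IHx ?(fP (Ordinal lt)) // ltnW.
Qed.

(** Undoing the inversion moves two entries to the other corners of the rectangle they span, so only
    counts at points of that rectangle change. *)
Lemma rk_tperm u (i j : 'I_n) x y : i < j -> u j < u i -> x <= n ->
  rk (tperm i j * u) x y = rk u x y + [&& i < x, x <= j, u j < y & y <= u i].
Proof.
move=> ij uji; elim: x => [|x IHx] lt; first by rewrite !rk0.
rewrite !(rkSl _ (Ordinal lt)) /= IHx ?(ltnW lt) // permM.
case: tpermP => [xi|xj|/eqP + /eqP].
- have ->: u (Ordinal lt) = u i by rewrite xi.
  have ->: x = i by rewrite -xi.
  by have [/=|] := ltnP (u i) y; have [/=|] := ltnP (u j) y; lia.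
- have ->: u (Ordinal lt) = u j by rewrite xj.
  have ->: x = j by rewrite -xj.
  by have [/=|] := ltnP (u i) y; have [/=|] := ltnP (u j) y; lia.
- by rewrite -!val_eqE /=; lia.
Qed.

End Ranks.

(** * The tableau criterion for the Bruhat order *)

(** Products compose left to right, so this reverses the values of [w]. Anti-fixed points become
    fixed points, 123 becomes 321, and rank functions increase along the Bruhat order. *)
Definition rv n (w : 'S_n) : 'S_n := (w * w0 n)%g.

Section Bruhat.
Variable n : nat.
Implicit Types u v w : 'S_n.

Lemma rvE w i : rv w i = rev_ord (w i).
Proof. by rewrite permM permE. Qed.

Lemma rv_inj : injective (@rv n).
Proof. exact: mulIg. Qed.

Lemma ltn_rv w i j : (rv w i < rv w j) = (w j < w i).
Proof. by rewrite !rvE /=; have := ltn_ord (w i); have := ltn_ord (w j); lia. Qed.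

Lemma ltn_inversions u (i j : 'I_n) : i < j -> u i < u j ->
  #|inversions u| < #|inversions (tperm i j * u)%g|.
Proof.
move=> ij uij; set t := tperm i j; set u' := (t * u)%g.
(* An injection into the inversions of [u'] other than [(i, j)]: positions are relabelled by [t]
   when this keeps their order, and left alone otherwise. *)
pose f (p : 'I_n * 'I_n) := if t p.1 < t p.2 then (t p.1, t p.2) else p.
have inv_ij : (i, j) \in inversions u' by rewrite inE /= ij !permM tpermL tpermR.
have f_inj : {in inversions u &, injective f}.
  move=> [p q] [p' q']; rewrite !inE /= /f /= => /andP [pq _] /andP [pq' _].
  case: ifP => c; case: ifP => c'; case=> //.
  - by move=> /perm_inj -> /perm_inj ->.
  - by move=> e1 e2; move: c'; rewrite -e1 -e2 !tpermK pq.
  - by move=> e1 e2; move: c; rewrite e1 e2 !tpermK pq'.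
  - by move=> -> ->.
suff /subset_leq_card : f @: inversions u \subset inversions u' :\ (i, j).
  by rewrite card_in_imset // (cardsD1 (i, j) (inversions u')) inv_ij.
apply/subsetP => _ /imsetP [[p q] + ->]; rewrite inE /= => /andP [pq upq].
rewrite /f /=; case: ifP => tpq.
  rewrite !inE /= !permM !tpermK upq tpq !andbT; apply/eqP => -[e1 e2].
  by move: pq; rewrite -[p](tpermK i j) -[q](tpermK i j) -/t e1 e2 tpermL tpermR; lia.
have npq : (p, q) != (i, j) by apply/eqP => -[e1 e2]; move: upq; rewrite e1 e2; lia.
rewrite in_setD1 npq inE /= pq !permM /=; move: pq upq tpq npq; rewrite /t xpair_eqE.
by case: (tpermP i j p) => [->|->|/eqP + /eqP +];
  case: (tpermP i j q) => [->|->|/eqP + /eqP +]; rewrite -!val_eqE /=; lia.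
Qed.

Lemma bruhat_step_rk v w x y : bruhat_step v w -> x <= n -> y <= n ->
  rk (rv v) x y <= rk (rv w) x y.
Proof.
move=> /andP [/existsP [i /existsP [j /eqP defw]] ltinv] lex ley.
wlog ij : i j defw / i < j.
  case: (ltngtP i j) => [lt|lt|/val_inj eq] W; [exact: (W i j) | apply: (W j i) => //|].
    by rewrite tpermC.
  by move: ltinv; rewrite defw eq tperm1 mul1g ltnn.
have [vij|vji|/val_inj /perm_inj eq] := ltngtP (v i) (v j).
- by rewrite defw /rv -mulgA rk_tperm ?ltn_rv // leq_addr.
(* Here [w] is increasing on [i], [j], so swapping back to [v] would increase the length, against
   the assumption on the step. *)
- have := @ltn_inversions w i j ij.
  rewrite defw !permM tpermL tpermR => /(_ vji).
  by rewrite mulgA tperm2 mul1g -defw; lia.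
- by move: ij; rewrite eq ltnn.
Qed.

Lemma bruhat_le_rk v w x y : bruhat_le v w -> x <= n -> y <= n ->
  rk (rv v) x y <= rk (rv w) x y.
Proof.
move=> /connectP [s + ->] lex ley; elim: s v => //= v' s IHs v /andP [vv' /IHs].
exact: leq_trans (bruhat_step_rk vv' lex ley).
Qed.

(* Exchange step of the tableau criterion: [i] is the first position where [u]
   and [z] differ, and [j] the first later one with [z i <= u j < u i]. *)
Lemma rk_exchange u z : u != z ->
    (forall x y, x <= n -> y <= n -> rk u x y <= rk z x y) ->
  exists i j : 'I_n, [/\ i < j, u j < u i &
    forall x y, x <= n -> y <= n -> rk (tperm i j * u) x y <= rk z x y].
Proof.
move=> neq_uz le_uz.
have /existsP [i0 ni0] : [exists i, u i != z i].
  apply: contraNT neq_uz; rewrite negb_exists => /forallP eq_uz.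
  by apply/eqP/permP => i; apply/eqP; have := eq_uz i; rewrite negbK.
case: (@arg_minnP _ i0 (fun i => u i != z i) val ni0) => i neq_i min_i.
have agree (k : 'I_n) : k < i -> u k = z k.
  by move=> ki; apply/eqP; apply: contraLR ki => /min_i; rewrite -leqNgt.
have eq_i y : rk u i y = rk z i y.
  have : i <= n by apply: ltnW.
  suff : forall x, x <= i -> x <= n -> rk u x y = rk z x y by move/(_ i (leqnn i)).
  elim=> [|x IHx] lxi lxn; first by rewrite !rk0.
  rewrite !(rkSl _ (Ordinal lxn)) /= IHx ?(ltnW lxi) ?(ltnW lxn) //.
  by rewrite agree.
have zu : z i < u i.
  rewrite ltn_neqAle eq_sym val_eqE neq_i /=.
  have := le_uz i.+1 (u i).+1 (ltn_ord _) (ltn_ord _).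
  by rewrite !rkSl eq_i; lia.
pose P (k : 'I_n) := [&& i < k, z i <= u k & u k < u i].
(* The position where [u] takes the value [z i] qualifies: it is not before [i], where [u] and [z]
   agree. *)
have P0 : P (u^-1 (z i))%g.
  rewrite /P permKV leqnn zu !andbT ltnNge leq_eqVlt; apply/norP; split.
    by apply: contra neq_i => /eqP/val_inj /(congr1 u); rewrite permKV => ->.
  apply/negP => /[dup] ki /agree; rewrite permKV => /perm_inj eq_i'.
  by move: ki; rewrite -eq_i' ltnn.
case: (@arg_minnP _ _ P val P0) => j /and3P [ij zuj uji] min_j.
exists i, j; split=> // x y lex ley; rewrite rk_tperm //.
have [/and4P [ix xj ujy yui]|_] := boolP [&& i < x, x <= j, u j < y & y <= u i];
  last by rewrite addn0 le_uz.
(* In rows [i, x) and columns [z i, y), [u] has no entry by the choice of [j], while [z] has one in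
   row [i]. Comparing ranks at column [z i] then gives a strict inequality at [y]. *)
suff [] : rk u x y + rk u i (z i) = rk u x (z i) + rk u i y
       /\ rk z x (z i) + rk z i y < rk z x y + rk z i (z i).
  by have := le_uz x (z i) lex (ltnW (ltn_ord _)); rewrite !eq_i; lia.
elim: x lex ix xj => // x IHx lex; rewrite ltnS leq_eqVlt => /orP [/eqP <-|ix] xj.
  by rewrite !rkSl; lia.
have [IH1 IH2] := IHx (ltnW lex) ix (ltnW xj).
rewrite !(rkSl _ (Ordinal lex)) /=.
have : ~~ P (Ordinal lex) by apply/negP => /min_j /=; lia.
by rewrite /P /= ix /=; lia.
Qed.

(** As long as [v] and [w] differ, an exchange in [rv v] is a Bruhat step up from [v] that keeps the
    rank inequality. The growing number of inversions bounds the number of steps. *)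
Lemma rk_bruhat_le v w :
    (forall x y, x <= n -> y <= n -> rk (rv v) x y <= rk (rv w) x y) ->
  bruhat_le v w.
Proof.
have [k] := ubnP (#|{: 'I_n * 'I_n}| - #|inversions v|).
elim: k v => // k IHk v ltk le_vw.
have [->|neq] := eqVneq v w; first exact: connect0.
have [|i [j [ij]]] := @rk_exchange (rv v) (rv w) _ le_vw.
  by rewrite (inj_eq rv_inj).
rewrite ltn_rv mulgA => vij le'.
have inv_lt := ltn_inversions ij vij.
apply: connect_trans (connect1 _) (IHk (tperm i j * v)%g _ le').
  by rewrite /bruhat_step inv_lt andbT; apply/existsP; exists i; apply/existsP; exists j.
rewrite -ltnS; apply: leq_trans ltk; rewrite ltnS; apply: ltn_sub2l (inv_lt).
exact: leq_trans inv_lt (max_card _).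
Qed.

End Bruhat.

(** * Generic minors and transversals *)

Lemma mxvec_index_inj m n (i i' : 'I_m) (j j' : 'I_n) :
  mxvec_index i j = mxvec_index i' j' -> (i, j) = (i', j').
Proof. by move=> /cast_ord_inj /enum_rank_inj. Qed.

Section Transversals.
Variable n : nat.
Implicit Types (w : 'S_n) (I : {set 'I_(n + n)}).

Let col I (j : 'I_n) := nth (lshift n j) (enum I) j.

Lemma col_inj I : #|I| = n -> injective (col I).
Proof.
move=> cardI j j' eq_col; have sz (i : 'I_n) : i < size (enum I) by rewrite -cardE cardI.
apply/val_inj/eqP => /=; rewrite -(nth_uniq (col I j) (sz j) (sz j') (enum_uniq I)).
rewrite (set_nth_default (lshift n j)) ?sz //.
by rewrite [X in _ == X](set_nth_default (lshift n j')) ?sz //; apply/eqP.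
Qed.

(** Without an admissible permutation every term of the determinant vanishes. Given one, setting its
    variables to 1 and all others to 0 turns the submatrix into a permutation matrix. *)
Lemma minor_generic_neq0 w I : #|I| = n ->
  (minor (generic_mx w) I != 0)%R
  = [exists s : 'S_n, [forall i, w i <= col I (s i) <= i + n]].
Proof.
move=> cardI; apply/idP/existsP => [nz|[s /forallP allowed]].
  apply/existsP; apply: contraNT nz => none; apply/eqP/big1 => s _.
  have /forallPn [i ni] : ~~ [forall i, w i <= col I (s i) <= i + n].
    by apply: contra none => ok; apply/existsP; exists s.
  by rewrite (bigD1 i) //= !mxE -/(col I (s i)) (negPf ni) GRing.mul0r GRing.mulr0.
pose v (k : 'I_(n * (n + n))) : rat :=
  ([exists i, k == mxvec_index i (col I (s i))]%:R)%R.
suff ev : map_mx (meval v) (colsub (col I) (generic_mx w)) = perm_mx s.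
  have : (\det (map_mx (meval v) (colsub (col I) (generic_mx w))) != 0)%R.
    by rewrite ev det_perm GRing.signr_eq0.
  by rewrite det_map_mx; apply: contraNneq; rewrite /minor => ->; rewrite GRing.rmorph0.
apply/matrixP => i j; rewrite !mxE.
have [<-|sij] := eqVneq (s i) j.
  rewrite allowed mevalXU /v; case: existsP => // -[]; by exists i.
case: ifP => _; last by rewrite GRing.rmorph0.
rewrite mevalXU /v; case: existsP => // -[i' /eqP /mxvec_index_inj [<- /(col_inj cardI) eq]].
by rewrite eq eqxx in sij.
Qed.

(** The matching runs from columns to rows, the direction in which [hall] delivers it; |I| = n makes
    it a bijection. *)
Lemma calP_matching w I : I \in calP w <-> #|I| = n /\
  exists2 h : 'I_(n + n) -> 'I_n, {in I &, injective h}
    & {in I, forall c : 'I_(n + n), w (h c) <= c <= h c + n}.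
Proof.
rewrite inE; split.
  case/andP => /eqP cardI; rewrite (minor_generic_neq0 _ cardI) => /existsP [s /forallP ok].
  split=> //; have lt c : c \in I -> index c (enum I) < n.
    by move=> cI; rewrite -[X in _ < X]cardI cardE index_mem mem_enum.
  have d : 'I_(n + n) -> 'I_n by move=> c; case: (split c).
  pose o c := insubd (d c) (index c (enum I)).
  have oE c : c \in I -> val (o c) = index c (enum I).
    by move=> cI; rewrite val_insubd lt.
  exists (fun c => (s^-1)%g (o c)).
    move=> c c' cI c'I /perm_inj /(congr1 val); rewrite !oE // => eq.
    by rewrite -[c](nth_index c (s := enum I)) ?mem_enum // eq nth_index ?mem_enum.
  move=> c cI; have := ok ((s^-1)%g (o c)).
  by rewrite permKV /col oE // nth_index ?mem_enum.
case=> cardI [h h_inj ok]; rewrite cardI eqxx (minor_generic_neq0 _ cardI).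
have colI j : col I j \in I by rewrite -mem_enum mem_nth // -cardE cardI.
have hc_inj : injective (h \o col I).
  by move=> j j' /= eq; apply/(col_inj cardI)/h_inj.
apply/existsP; exists ((perm hc_inj)^-1)%g; apply/forallP => i.
have := ok _ (colI ((perm hc_inj)^-1 i)%g).
have -> // : h (col I ((perm hc_inj)^-1 i)%g) = i.
by rewrite -[RHS](permKV (perm hc_inj)) [RHS]permE.
Qed.

End Transversals.

(** * Rank criteria for the transversals and for the top sets *)

Section RankCriterion.
Variable n : nat.
Implicit Types (w : 'S_n) (I : {set 'I_(n + n)}).

(** These are the sets A and B of the overview. Mirroring the first half of [2n] turns a window
    around the middle into a pair of initial segments. *)
Definition leftI I : {set 'I_n} := [set a | lshift n (rev_ord a) \in I].
Definition rightI I : {set 'I_n} := [set b | rshift n b \in I].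

Lemma card_leftI_rightI I : #|I| = #|rightI I| + #|leftI I|.
Proof.
rewrite -!sum1dep_card -sum1_card big_split_ord /= addnC; congr (_ + _).
by rewrite (reindex_inj rev_ord_inj).
Qed.

Lemma card_window I (x y : nat) :
  #|[set c in I | n - y <= c < n + x]| = cnt (rightI I) x + cnt (leftI I) y.
Proof.
rewrite card_leftI_rightI; congr (_ + _); apply: eq_card => i; rewrite !inE /=.
  by rewrite ltn_add2l (leq_trans (leq_subr _ _)) ?leq_addr.
by congr andb; have := ltn_ord i; lia.
Qed.

Lemma card_offwindow I (x y : nat) :
  #|[set c in I | (c < n - y) || (n + x <= c)]|
  + (cnt (rightI I) x + cnt (leftI I) y) = #|I|.
Proof.
rewrite -card_window -(cardsID [set c : 'I_(n + n) | n - y <= c < n + x] I) addnC.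
congr (_ + _); apply: eq_card => c; rewrite !inE // andbC; congr andb.
by lia.
Qed.

Lemma card_offrank (u : 'S_n) (x y : nat) : x <= n ->
  #|[set i : 'I_n | (x <= i) || (y <= u i)]| + rk u x y = n.
Proof.
move=> le; rewrite -[RHS](card_ord n) -(cardC [set i : 'I_n | (x <= i) || (y <= u i)]).
congr (_ + _); apply: eq_card => i; rewrite !inE; lia.
Qed.

(** Take the least element of [T]; for empty [T] the value n makes both clauses vacuous. *)
Lemma lower_end (T : {set 'I_n}) : exists m, [/\ m <= n, {in T, forall a : 'I_n, m <= a}
  & forall z, m <= z < n -> exists2 a : 'I_n, a \in T & a <= z].
Proof.
have [->|[a0 a0T]] := set_0Vmem T; first by exists n; split=> // [a|z]; rewrite ?inE //; lia.
case: (@arg_minnP _ a0 (mem T) val a0T) => a aT min_a; exists a; split=> //.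
  exact: ltnW.
by move=> z /andP [az _]; exists a.
Qed.

(** Every interval crosses the middle of [2n], so the rows adjacent to a set of columns depend only
    on its elements nearest the middle on either side. Hall's condition is thus needed only for
    complements of windows, where passing to complements gives the rank inequality. *)
Lemma calP_rank w I : I \in calP w <-> #|I| = n /\
  forall x y, x <= n -> y <= n ->
    rk (rv w) x y <= cnt (rightI I) x + cnt (leftI I) y.
Proof.
rewrite calP_matching; split=> -[cardI].
  case=> h h_inj ok; split=> // x y lex ley.
  have := card_offwindow I x y; have := card_offrank (rv w) y lex.
  suff : #|[set c in I | (c < n - y) || (n + x <= c)]|
         <= #|[set i : 'I_n | (x <= i) || (y <= rv w i)]| by rewrite cardI; lia.
  rewrite -(card_in_imset (f := h)); last first.
    by move=> c c'; rewrite !inE => /andP [cI _] /andP [c'I _]; apply: h_inj.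
  apply: subset_leq_card; apply/subsetP => _ /imsetP [c + ->].
  rewrite !inE rvE /= => /andP [/ok]; lia.
move=> le_rk; split=> //.
have d : 'I_(n + n) -> 'I_n by move=> c; case: (split c).
pose e (c : 'I_(n + n)) (i : 'I_n) := w i <= c <= i + n.
have [S SI|h h_inj ok] := @hall _ _ e d I; last by exists h.
rewrite /e {e}.
(* Together, [y] and [x] cut out the largest window around the middle that misses [S]. *)
have [y [ley minY Y]] := lower_end (leftI S).
have [x [lex minX X]] := lower_end (rightI S).
apply: (@leq_trans #|[set c in I | (c < n - y) || (n + x <= c)]|); last first.
  apply: (@leq_trans #|[set i : 'I_n | (x <= i) || (y <= rv w i)]|).
    have := card_offwindow I x y; have := card_offrank (rv w) y lex.
    by have := le_rk x y lex ley; rewrite cardI; lia.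
  apply: subset_leq_card; apply/subsetP => i; rewrite !inE rvE => lei; apply/existsP.
  case: (leqP x i) lei => [xi _|_ /= yi].
    have [|b] := X i; first by rewrite xi /=.
    rewrite inE => bS bi; exists (rshift n b); rewrite bS /=.
    by have := ltn_ord (w i); lia.
  have [|a] := Y (rev_ord (w i)); first by rewrite yi ltn_ord.
  rewrite inE => aS ai; exists (lshift n (rev_ord a)); rewrite aS /=.
  by move: ai => /=; move: (w i) => wi; have := ltn_ord a; have := ltn_ord wi; lia.
apply: subset_leq_card; apply/subsetP => c cS; rewrite inE (subsetP SI) //=; move: cS.
case: (split_ordP c) => [a ->|b ->] cS /=.
  have := minY (rev_ord a); rewrite inE rev_ordK => /(_ cS) /=.
  by have := ltn_ord a; lia.
by have := minX b; rewrite inE => /(_ cS); lia.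
Qed.

Lemma calP_anti v w : bruhat_le v w -> calP w \subset calP v.
Proof.
move=> le_vw; apply/subsetP => I /calP_rank [cardI le_rk]; apply/calP_rank.
split=> // x y lex ley; apply: leq_trans (le_rk _ _ lex ley).
exact: bruhat_le_rk.
Qed.

(* The rank function of the unique maximal permutation whose transversals
   contain [I]. *)
Definition top_rank I x y := minn (minn x y) (cnt (rightI I) x + cnt (leftI I) y).

Lemma top_rankP I : #|I| = n ->
  exists w, forall x y, x <= n -> y <= n -> rk (rv w) x y = top_rank I x y.
Proof.
move=> cardI; have := cardI; rewrite card_leftI_rightI => cardLR.
have [||||x y ltx lty|u uE] := @perm_of_rank n (top_rank I); rewrite /top_rank.
- by move=> y _; rewrite cnt0; lia.
- by move=> x _; rewrite cnt0; lia.
(* The two sets have n elements in total and at most n - y of [leftI I] lie beyond y, so the counts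
   add up to at least y. *)
- by move=> y ley; rewrite cnt_full; have := card_leq_cnt (leftI I) ley; lia.
- by move=> x lex; rewrite cnt_full; have := card_leq_cnt (rightI I) lex; lia.
- have [b1 ->] := cntS_nat (rightI I) ltx; have [b2 ->] := cntS_nat (leftI I) lty.
  lia.
exists (u * w0 n)%g => x y lex ley; rewrite -[RHS]uE //; congr rk; apply/permP => i.
by rewrite !permM !permE rev_ordK.
Qed.

Lemma calQ_rank w I : I \in calQ w <-> #|I| = n /\
  forall x y, x <= n -> y <= n -> rk (rv w) x y = top_rank I x y.
Proof.
rewrite inE; split=> [/andP [notP /calP_rank [cardI le_rk]]|[cardI eq_rk]].
  split=> //; have [v vE] := top_rankP cardI.
  have le_wv : bruhat_le w v.
    apply: rk_bruhat_le => x y lex ley; rewrite vE // !leq_min le_rk // andbT.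
    by rewrite rk_leql ?rk_leqr.
  have [->//|neq] := eqVneq w v; case/bigcupP: notP; exists v.
    by rewrite /bruhat_lt le_wv.
  by apply/calP_rank; split=> // x y lex ley; rewrite vE // geq_minr.
apply/andP; split; last first.
  by apply/calP_rank; split=> // x y lex ley; rewrite eq_rk // geq_minr.
apply/bigcupP => -[v /andP [le_wv /eqP neq] /calP_rank [_ le_rk]]; apply/neq/rv_inj/rk_inj.
move=> x y lex ley; apply/eqP; rewrite eqn_leq bruhat_le_rk //= eq_rk //.
by rewrite !leq_min le_rk // andbT rk_leql ?rk_leqr.
Qed.

Lemma calQ_disjoint v w : v != w -> [disjoint calQ v & calQ w].
Proof.
apply: contraNT => /pred0Pn [I /= /andP [/calQ_rank [_ vE] /calQ_rank [_ wE]]].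
by apply/eqP/rv_inj/rk_inj => x y lex ley; rewrite vE ?wE.
Qed.

(* At the entry [(i, u i)] of the rank function of [u], the sum of the two
   counts cannot be the strict minimum, since it has no mixed difference. *)
Lemma top_rank_entry I (u : 'S_n) (i : 'I_n) :
    (forall x y, x <= n -> y <= n -> rk u x y = top_rank I x y) ->
  rk u i (u i) = minn i (u i).
Proof.
move=> uE; have lti := ltn_ord i; have ltu := ltn_ord (u i).
have := rkSl u i (u i); have := rkSl u i (u i).+1; have := rkSr u i i.
rewrite ltnn ltnSn !uE ?(ltnW lti) ?(ltnW ltu) // /top_rank.
by rewrite !cntS; lia.
Qed.

Lemma calQ_contains123 w : contains123 w -> calQ w = set0.
Proof.
case/existsP => i /existsP [j /existsP [k /and4P [ij jk wij wjk]]].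
apply/eqP; rewrite -subset0; apply/subsetP => I /calQ_rank [_ /top_rank_entry wE].
(* In [rv w] a larger entry precedes [j] and a smaller one follows it, so the rank is below both
   arguments, against [top_rank_entry]. *)
have := wE j; have [ltj ltk] := (ltn_ord j, ltn_ord (rv w j)).
have : rk (rv w) j (rv w j) < j.
  by apply: (rk_ltl ij (ltnW ltj)); rewrite ltnW // ltn_rv.
have : rk (rv w) j (rv w j) < rv w j.
  by apply: (rk_ltr (ltnW jk) _ (ltnW ltk)); rewrite ltn_rv.
lia.
Qed.

End RankCriterion.

(** * Maximal intervals *)

(** The induction runs over duplicate-free lists, so that the choice at the head can be set without
    disturbing the tail. *)
Lemma mem_bigoplus (T J : finType) (F : J -> {set {set T}}) (S : {set J}) (X : {set T}) :
  X \in \big[@oplus _/[set set0]]_(A in S) F A <->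
  exists2 f : J -> {set T}, {in S, forall A, f A \in F A} & X = \bigcup_(A in S) f A.
Proof.
suff mem_seq r : uniq r -> forall X : {set T}, X \in \big[@oplus _/[set set0]]_(A <- r) F A <->
    exists2 f : J -> {set T}, {in r, forall A, f A \in F A} & X = \bigcup_(A <- r) f A.
  rewrite -big_filter mem_seq ?filter_uniq ?index_enum_uniq //.
  split=> -[f fF ->]; exists f; rewrite ?big_filter //.
    by move=> A AS; apply: fF; rewrite mem_filter AS mem_index_enum.
  by move=> A; rewrite mem_filter => /andP [/fF].
elim: r => [_|A r IHr /= /andP [Ar uniq_r]] {}X.
  rewrite !big_nil inE; split=> [/eqP ->|[f _ ->]]; last by rewrite big_nil.
  by exists (fun=> set0) => //; rewrite big_nil.
rewrite big_cons; split.
  case/imset2P => Y Z YF /(IHr uniq_r) [f fF ->] ->.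
  exists (fun B => if B == A then Y else f B).
    by move=> B; rewrite inE; case: eqP => [-> //|_] /=; apply: fF.
  rewrite big_cons eqxx; congr (_ :|: _); apply: eq_big_seq => B Br.
  by case: eqP Br Ar => // -> ->.
case=> f fF ->; rewrite big_cons; apply: imset2_f; first by apply: fF; rewrite mem_head.
by apply/IHr => //; exists f => // B Br; apply: fF; rewrite inE Br orbT.
Qed.

Section Intervals.
Variable n : nat.
Implicit Types (S K : {set 'I_n}).

(** Half-open, so that the ends are themselves arguments of the counting functions. *)
Definition itv (s t : nat) : {set 'I_n} := [set x : 'I_n | s <= x < t].

(** The last two clauses express maximality: neither s - 1 nor t is in [S]. They quantify over [S]
    because these numbers may fall outside the index range. *)
Lemma max_intervals_itv S K : K \in max_intervals S ->
  exists s t, [/\ s < t <= n, K = itv s t, K \subset S,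
    {in S, forall k : 'I_n, k.+1 != s} & {in S, forall k : 'I_n, k != t :> nat}].
Proof.
rewrite inE => /maxsetP [/andP [/existsP [a /existsP [b /andP [ab /eqP defK]]] KS] maxK].
have max_ab (c d : 'I_n) : c <= a -> b <= d -> itv c d.+1 \subset S ->
    forall x : 'I_n, c <= x <= d -> a <= x <= b.
  move=> ca bd cdS x; suff /setP /(_ x) : itv c d.+1 = K by rewrite defK !inE => <-.
  apply: maxK; last by apply/subsetP => y; rewrite defK !inE; lia.
  rewrite cdS andbT; apply/existsP; exists c; apply/existsP; exists d.
  by rewrite (leq_trans ca (leq_trans ab bd)) /=.
have abS (x : 'I_n) : a <= x <= b -> x \in S.
  by move=> xab; apply: (subsetP KS); rewrite defK inE.
exists a, b.+1; split=> //.
- by rewrite ltnS ab ltn_ord.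
- move=> k kS; apply/eqP => ka; suff /max_ab : itv k b.+1 \subset S.
    by move/(_ ltac:(lia) (leqnn b) k); lia.
  apply/subsetP => x; rewrite inE => kxb.
  by have [->//|xk] := eqVneq x k; apply: abS; rewrite -val_eqE /= in xk; lia.
- move=> k kS; apply/eqP => kb; suff /max_ab : itv a k.+1 \subset S.
    by move/(_ (leqnn a) ltac:(lia) k); lia.
  apply/subsetP => x; rewrite inE => axk.
  by have [->//|xk] := eqVneq x k; apply: abS; rewrite -val_eqE /= in xk; lia.
Qed.

Lemma max_intervals_cover S x : x \in S -> exists2 K, K \in max_intervals S & x \in K.
Proof.
move=> xS; have [|K maxK xK] := @maxset_exists _
  (fun B : {set 'I_n} => is_interval B && (B \subset S)) [set x].
  rewrite sub1set xS andbT; apply/existsP; exists x; apply/existsP; exists x.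
  rewrite leqnn; apply/eqP/setP => y; rewrite !inE -val_eqE /=; lia.
by exists K; rewrite ?inE // -sub1set.
Qed.

Lemma max_intervals_eq S K K' x : K \in max_intervals S -> K' \in max_intervals S ->
  x \in K -> x \in K' -> K = K'.
Proof.
suff sub K1 K2 : K1 \in max_intervals S -> K2 \in max_intervals S ->
    x \in K1 -> x \in K2 -> K1 \subset K2.
  by move=> mK mK' xK xK'; apply/eqP; rewrite eqEsubset !sub.
move=> /max_intervals_itv [s [t [/andP [_ tn] -> KS _ _]]].
move=> /max_intervals_itv [s' [t' [/andP [_ tn'] -> _ sS' tS']]].
rewrite inE => /andP [sx xt]; rewrite inE => /andP [sx' xt'].
have xn := ltn_ord x.
have ss' : s' <= s.
  rewrite leqNgt; apply/negP => lt; have lt' : s'.-1 < n by lia.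
  by have := sS' (Ordinal lt'); rewrite (subsetP KS) ?inE /=; lia.
have tt' : t <= t'.
  rewrite leqNgt; apply/negP => lt; have lt' : t' < n by lia.
  by have := tS' (Ordinal lt'); rewrite (subsetP KS) ?inE /=; lia.
by apply/subsetP => y; rewrite !inE; lia.
Qed.

Lemma card_itv s t : s <= t -> t <= n -> #|itv s t| = t - s.
Proof.
move=> st tn; have := card_ord (t - s) => <-.
have lt (j : 'I_(t - s)) : s + j < n by have := ltn_ord j; lia.
rewrite -(card_imset _ (f := fun j => Ordinal (lt j))); last first.
  by move=> j j' /(congr1 val) /= /addnI /val_inj.
apply: eq_card => x; rewrite inE; apply/andP/imsetP => [[sx xt]|[j _ ->] /=].
  have lt' : x - s < t - s by lia.
  by exists (Ordinal lt') => //; apply: val_inj => /=; lia.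
by have := ltn_ord j; lia.
Qed.

Lemma cnt_itv S s t m : s <= m <= t -> cnt S m = cnt S s + cnt (S :&: itv s t) m.
Proof.
move=> smt; rewrite /cnt -(cardsID [set i : 'I_n | i < s]).
by congr (_ + _); apply: eq_card => i; rewrite !inE; case: (i \in S) => //=; lia.
Qed.

Lemma cnt_sub0 S s : {in S, forall i : 'I_n, s <= i} -> cnt S s = 0.
Proof.
move=> le; apply/eqP; rewrite cards_eq0; apply/eqP/setP => i; rewrite !inE.
by apply/negP => /andP [/le]; rewrite leqNgt => /negP.
Qed.

Lemma mem_Zset_l K a : (lshift n (rev_ord a) \in Zset K) = (a \in K).
Proof.
rewrite inE; apply/orP/idP => [[]/imsetP [x xK /eqP]|aK]; last by left; apply/imset_f.
  by rewrite eq_lshift (inj_eq rev_ord_inj) => /eqP ->.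
by rewrite eq_lrshift.
Qed.

Lemma mem_Zset_r K b : (rshift n b \in Zset K) = (b \in K).
Proof.
rewrite inE; apply/orP/idP => [[]/imsetP [x xK /eqP]|bK]; last by right; apply/imset_f.
  by rewrite eq_rlshift.
by rewrite eq_rshift => /eqP ->.
Qed.

(** Here [Zset K] consists of the blocks [n - t, n - s) and [n + s, n + t), and a strictly sorted
    list is determined by its members. *)
Lemma fK_itv s t : s < t -> t <= n -> let K := itv s t in
  forall i : 'I_(#|K| + #|K|),
    fK i = (if i < #|K| then n - t + i else n + s + (i - #|K|)) :> nat.
Proof.
move=> st tn K i; have cK : #|K| = t - s by apply: card_itv; rewrite // ltnW.
pose e j := if j < #|K| then n - t + j else n + s + (j - #|K|).
have sz : size (enum (Zset K)) = #|K| + #|K| by rewrite -cardE card_Zset.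
have c0 := fK i.
suff enumZ : map val (enum (Zset K)) = map e (iota 0 (#|K| + #|K|)).
  rewrite /fK (enum_val_nth c0) /= -(nth_map _ 0) ?sz // enumZ.
  by rewrite (nth_map 0) ?size_iota // nth_iota.
apply: (irr_sorted_eq ltn_trans ltnn).
- rewrite {1}/enum_mem -enumT.
  apply: (subseq_sorted ltn_trans (map_subseq val (filter_subseq _ _))).
  by rewrite val_enum_ord iota_ltn_sorted.
- apply: (homo_sorted_in (P := fun j => j < #|K| + #|K|) (e := ltn)).
  + by move=> j j'; rewrite !unfold_in /e cK /= => lj lj' jj'; do 2!case: ifP; lia.
  + by apply/allP => j; rewrite mem_iota.
  + exact: iota_ltn_sorted.
move=> c; apply/mapP/mapP => [[z + ->]|[j + ->]].
  rewrite mem_enum; case: (split_ordP z) => [a ->|b ->].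
    rewrite -[a]rev_ordK mem_Zset_l inE /= => ab; exists (a - (n - t)).
      by rewrite mem_iota cK; move: ab; have := ltn_ord a; lia.
    by rewrite /e cK; move: ab; have := ltn_ord a; case: ifP; lia.
  rewrite mem_Zset_r inE => ab; exists (b - s + #|K|); first by rewrite mem_iota cK; lia.
  by rewrite /e /=; case: ifP; lia.
rewrite mem_iota /e cK => /andP [_ jkk]; case: (ltnP j (t - s)) => [jk|kj].
  have lt : s + (t - s - j.+1) < n by lia.
  exists (lshift n (rev_ord (Ordinal lt))); last by rewrite /=; lia.
  by rewrite mem_enum mem_Zset_l inE /=; lia.
have lt : s + (j - (t - s)) < n by lia.
exists (rshift n (Ordinal lt)); last by rewrite /=; lia.
by rewrite mem_enum mem_Zset_r inE /=; lia.
Qed.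

Lemma rk1 k x y : x <= k -> y <= k -> rk (1%g : 'S_k) x y = minn x y.
Proof.
move=> lex ley; case: (leqP x y) => xy.
  by rewrite rk_eql // => i; rewrite perm1 => /leq_trans ->.
by rewrite rk_eqr // => i; rewrite perm1 => /leq_trans -> //; apply: ltnW.
Qed.

(** Reversing the values of [w0] gives the identity, of rank min(x, y); as counts are monotone, only
    the diagonal inequalities matter. *)
Lemma calP_w0 k I : I \in calP (w0 k) <-> #|I| = k /\
  forall m, m <= k -> m <= cnt (rightI I) m + cnt (leftI I) m.
Proof.
have E : rv (w0 k) = 1%g by apply/permP => i; rewrite !(permM, permE) rev_ordK.
rewrite calP_rank E; split=> -[cI le]; split=> //.
  by move=> m lem; have := le m m lem lem; rewrite rk1 // minnn.
move=> x y lex ley; rewrite rk1 //; apply: leq_trans (le _ _) _; rewrite ?geq_min ?lex //.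
by apply: leq_add; apply: leq_cnt; rewrite ?geq_minl ?geq_minr.
Qed.

(** This is [calP_w0] transported along [fK]: the equation is the cardinality condition, the
    inequalities are the diagonal ones. *)
Lemma calPK_itv s t (J : {set 'I_(n + n)}) : s < t -> t <= n ->
  J \in calPK (itv s t) <->
  [/\ J \subset Zset (itv s t), cnt (rightI J) t + cnt (leftI J) t = t - s
    & forall m, s <= m <= t -> m <= s + (cnt (rightI J) m + cnt (leftI J) m)].
Proof.
move=> st tn; set K := itv s t; have cK : #|K| = t - s by apply: card_itv; rewrite // ltnW.
have fK_inj : injective (@fK n K).
  by move=> i j /enum_val_inj /cast_ord_inj.
(* On both the right set and the mirrored left set, [fK] acts as a shift by [s]. *)
have shift (I : {set 'I_(#|K| + #|K|)}) m : m <= #|K| -> let J' := [set fK i | i in I] in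
    cnt (rightI J') (s + m) = cnt (rightI I) m /\ cnt (leftI J') (s + m) = cnt (leftI I) m.
  move=> + J'; have J'Z : J' \subset Zset K by rewrite -fK_image; apply: imsetS; apply/subsetP.
  elim: m => [_|m IHm lt].
    rewrite addn0 !cnt0; split; apply: cnt_sub0 => a; rewrite inE => /(subsetP J'Z).
      by rewrite mem_Zset_r inE => /andP [].
    by rewrite mem_Zset_l inE => /andP [].
  have lt' : s + m < n by lia.
  rewrite addnS !(cntS _ (Ordinal lt')) !(cntS _ (Ordinal lt)) /=.
  have [-> ->] := IHm (ltnW lt); split; congr (_ + nat_of_bool _); rewrite !inE.
    have -> : rshift n (Ordinal lt') = fK (rshift #|K| (Ordinal lt)).
      by apply: ord_inj; rewrite (fK_itv st tn) /= -/K cK; case: ifP; lia.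
    by rewrite mem_imset.
  have -> : lshift n (rev_ord (Ordinal lt')) = fK (lshift #|K| (rev_ord (Ordinal lt))).
    by apply: ord_inj; rewrite (fK_itv st tn) /= -/K cK; case: ifP; lia.
  by rewrite mem_imset.
split.
  case/imsetP => I /calP_w0 [cI ballot] ->.
  have sk : s + #|K| = t by lia.
  split.
  - by rewrite -fK_image; apply: imsetS; apply/subsetP.
  - have := shift I #|K| (leqnn _); rewrite /= sk => -[-> ->].
    by rewrite !cnt_full -card_leftI_rightI cI.
  - move=> m smt; have lem : m - s <= #|K| by lia.
    have := shift I (m - s) lem; rewrite /= subnKC; last by lia.
    by case=> -> ->; rewrite -leq_subLR; apply: ballot.
case=> JZ bal ballot; pose I := [set i : 'I_(#|K| + #|K|) | fK i \in J].
have defJ : J = [set fK i | i in I].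
  apply/setP => c; apply/idP/imsetP => [cJ|[i + ->]]; last by rewrite inE.
  have := subsetP JZ _ cJ; rewrite -/K -fK_image => /imsetP [i _ ci].
  by exists i => //; rewrite inE -ci.
rewrite defJ; apply: imset_f; apply/calP_w0; split.
  have := shift I #|K| (leqnn _); rewrite /= -defJ !cnt_full.
  by rewrite card_leftI_rightI => -[<- <-]; rewrite cK subnKC // ltnW.
move=> m lem; have := shift I m lem; rewrite /= -defJ => -[<- <-].
by have := ballot (s + m); lia.
Qed.

End Intervals.

(** * 321-avoiding permutations and the description of the top sets *)

Section Avoiding.
Variable n : nat.
Implicit Types (u w : 'S_n) (I : {set 'I_(n + n)}) (A B F : {set 'I_n}).

Definition lr_max u (j : 'I_n) : Prop := forall i : 'I_n, i < j -> u i < u j.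
Definition rl_min u (j : 'I_n) : Prop := forall k : 'I_n, j < k -> u j < u k.
(** An entry of neither kind would be the middle of a 321 pattern. *)
Definition avoids321 u : Prop := forall j, lr_max u j \/ rl_min u j.

Lemma lr_minimaP w j : reflect (lr_max (rv w) j) (j \in lr_minima w).
Proof.
rewrite inE; apply: (iffP forallP) => [lr i ij|lr i].
  by rewrite ltn_rv; apply: (implyP (lr i)).
by apply/implyP => /lr; rewrite ltn_rv.
Qed.

Lemma rl_maximaP w j : reflect (rl_min (rv w) j) (j \in rl_maxima w).
Proof.
rewrite inE; apply: (iffP forallP) => [rl i ij|rl i].
  by rewrite ltn_rv; apply: (implyP (rl i)).
by apply/implyP => /rl; rewrite ltn_rv.
Qed.

Lemma avoids123_rv w : ~~ contains123 w -> avoids321 (rv w).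
Proof.
move=> av j; have [/lr_minimaP|nlr] := boolP (j \in lr_minima w); first by left.
have [/rl_maximaP|nrl] := boolP (j \in rl_maxima w); first by right.
case/negP: av; move: nrl nlr; rewrite !inE !negb_forall.
move=> /existsP [k]; rewrite negb_imply -leqNgt => /andP [jk wjk].
move=> /existsP [i]; rewrite negb_imply -leqNgt => /andP [ij wij].
apply/existsP; exists i; apply/existsP; exists j; apply/existsP; exists k.
rewrite ij jk !ltn_neqAle wij wjk !andbT /= !val_eqE !(inj_eq perm_inj) -!val_eqE /=.
lia.
Qed.

(** The [j] entries before position [j] have distinct values below [u j]. *)
Lemma lr_max_leq u (j : 'I_n) : lr_max u j -> j <= u j.
Proof.
move=> lr; have := @rk_leqr n u j (u j) (ltnW (ltn_ord _)).
by rewrite rk_eql // ltnW.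
Qed.

Lemma rl_min_lt u (i j : 'I_n) : rl_min u j -> u i < u j -> i < j.
Proof.
move=> rl uij; rewrite ltnNge leq_eqVlt; apply/negP => /orP [/eqP /ord_inj ji|/rl].
  by rewrite ji ltnn in uij.
by rewrite ltnNge ltnW.
Qed.

Lemma rl_min_geq u (j : 'I_n) : rl_min u j -> u j <= j.
Proof.
move=> rl; have := @rk_leql n u j (u j) (ltnW (ltn_ord _)).
by rewrite rk_eqr ?(ltnW (ltn_ord (u j))) // => i; apply: rl_min_lt.
Qed.

Lemma avoids321_gt u (j : 'I_n) : avoids321 u -> j < u j -> lr_max u j.
Proof. by move=> /(_ j) [//|/rl_min_geq]; lia. Qed.

Lemma avoids321_lt u (j : 'I_n) : avoids321 u -> u j < j -> rl_min u j.
Proof. by move=> /(_ j) [/lr_max_leq|//]; lia. Qed.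

(** If the entries before a fixed point lie below it, they use up all smaller values, so those after
    it are larger; the converse is symmetric. *)
Lemma avoids321_fixed u (j : 'I_n) : avoids321 u -> u j = j -> lr_max u j /\ rl_min u j.
Proof.
move=> av uj; suff E : lr_max u j <-> rl_min u j by case: (av j) => /[dup] /E.
have lej := ltnW (ltn_ord j); split=> [lr k jk|rl i ij].
  have rj : rk u j j = j by apply: rk_eql => // i /lr; rewrite uj.
  rewrite uj ltnNge; apply/negP => ukj; suff : rk u j j < j by rewrite rj ltnn.
  apply: (rk_ltr (ltnW jk)) => //; rewrite ltn_neqAle ukj andbT.
  by rewrite -[X in _ != X](congr1 val uj) val_eqE (inj_eq perm_inj) -val_eqE /=; lia.
have rj : rk u j j = j by apply: rk_eqr => // i' ui'; apply: (rl_min_lt rl); rewrite uj.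
rewrite uj ltnNge; apply/negP => jui; suff : rk u j j < j by rewrite rj ltnn.
exact: rk_ltl jui.
Qed.

Lemma avoids321V u : avoids321 u -> avoids321 u^-1.
Proof.
move=> av a; case: (av (u^-1 a)%g) => [lr|rl]; [right => b ab|left => b ab].
  rewrite ltnNge leq_eqVlt; apply/negP => /orP [/eqP /ord_inj /perm_inj e|/lr].
    by rewrite e ltnn in ab.
  by rewrite !permKV; lia.
by apply: (rl_min_lt rl); rewrite !permKV.
Qed.

(** Left-to-right maxima of [rv w] lie weakly above the diagonal, and fixed points are extrema of
    both kinds, so the difference keeps the strict excedances. *)
Lemma mem_Lset w j : ~~ contains123 w -> (j \in Lset w) = (j < rv w j).
Proof.
move=> /avoids123_rv av; rewrite inE; apply/andP/idP => [[nrl /lr_minimaP lr]|lt].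
  rewrite ltn_neqAle lr_max_leq // andbT; apply: contra nrl => /eqP /ord_inj /esym uj.
  by apply/rl_maximaP; case: (avoids321_fixed av uj).
split; last exact/lr_minimaP/avoids321_gt.
by apply: contraL lt => /rl_maximaP /rl_min_geq; rewrite -leqNgt.
Qed.

Lemma mem_Rset w j : ~~ contains123 w -> (j \in Rset w) = (rv w j < j).
Proof.
move=> /avoids123_rv av; rewrite inE; apply/andP/idP => [[nlr /rl_maximaP rl]|lt].
  rewrite ltn_neqAle rl_min_geq // andbT; apply: contra nlr => /eqP /ord_inj uj.
  by apply/lr_minimaP; case: (avoids321_fixed av uj).
split; last exact/rl_maximaP/avoids321_lt.
by apply: contraL lt => /lr_minimaP /lr_max_leq; rewrite -leqNgt.
Qed.

Lemma mem_antifixed w j : (j \in antifixed w) = (rv w j == j).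
Proof. by rewrite inE rvE (can2_eq rev_ordK rev_ordK). Qed.

(** * Recovering the rank function from balanced sets *)

Section Counts.
Variables (u : 'S_n) (A B F : {set 'I_n}).
Hypothesis av : avoids321 u.
Hypothesis FE : forall i, (i \in F) = (u i == i).
Hypothesis AE : forall i, i \notin F -> (i \in A) = ((u^-1)%g i < i).
Hypothesis BE : forall i, i \notin F -> (i \in B) = (u i < i).

Let bal x := cnt (B :&: F) x + cnt (A :&: F) x.

Lemma cntB x : cnt B x = cnt (B :&: F) x + cnt [set i : 'I_n | u i < i] x.
Proof.
rewrite /cnt -(cardsID F); congr (_ + _); apply: eq_card => i; rewrite !inE.
  by rewrite andbAC.
case: (boolP (i \in F)) => iF /=; last by rewrite BE.
by move: iF; rewrite FE => /eqP ->; rewrite ltnn.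
Qed.

(** Off [F], the set [A] consists of the values at excedances, so the count is carried along [u]. *)
Lemma cntA y : cnt A y = cnt (A :&: F) y + cnt [set i : 'I_n | i < u i < y] n.
Proof.
rewrite cnt_full -(card_imset _ (@perm_inj _ u)) /cnt -(cardsID F); congr (_ + _).
  by apply: eq_card => i; rewrite !inE andbAC.
apply: eq_card => i; rewrite !inE; apply/andP/imsetP => [[iF /andP [iA iy]]|[j + ->]].
  by exists (u^-1 i)%g; rewrite ?inE permKV // -AE // iA.
rewrite inE => /andP [ju uy].
have uF : u j \notin F.
  by rewrite FE (inj_eq perm_inj); apply: contraL ju => /eqP ->; rewrite ltnn.
by rewrite uF AE // permK ju.
Qed.

(** For i < x <= y, the bound u(i) < y is automatic unless i is an excedance. *)
Lemma rk_decomp x y : x <= y -> y <= n ->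
  rk u x y = cnt [set i : 'I_n | u i < i] x + cnt F x + cnt [set i : 'I_n | i < u i < y] x.
Proof.
elim: x => [|x IHx] xy yn; first by rewrite rk0 !cnt0.
have xn : x < n := leq_trans xy yn.
rewrite (rkSl _ (Ordinal xn)) !(cntS _ (Ordinal xn)) /= IHx ?(ltnW xy) // !inE FE -val_eqE /=.
lia.
Qed.

(** If the first [x] entries all lie below [y], the rank is [x] and [bal_ge] makes the counts at
    least [x]. Otherwise some [i < x] has [u i >= y]; 321-avoidance then excludes fixed points
    strictly between [i] and [y], and excedances from [x] on with value below [y], so [bal_eq] makes
    the counts equal the rank. *)
Lemma rk_half x y : 
    (forall x, x <= n -> cnt F x <= bal x) ->
    (forall x, x <= n -> {in F, forall k : 'I_n, k.+1 != x} -> cnt F x = bal x) ->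
  x <= y -> y <= n -> rk u x y = minn x (cnt B x + cnt A y).
Proof.
move=> bal_ge bal_eq xy yn; have xn := leq_trans xy yn.
have dec := rk_decomp xy yn; have := bal_ge x xn.
have := leq_cnt [set i : 'I_n | i < u i < y] xn; have := leq_cnt (A :&: F) xy.
rewrite cntB cntA; have := rk_leql u y xn.
have [/existsP [i /andP [ix yui]]|none] := boolP [exists i : 'I_n, (i < x) && (y <= u i)].
  have lui := ltn_ord (u i).
  have nofix (k : 'I_n) : k \in F -> i < k -> y <= k.
    rewrite FE => /eqP uk ik; have [lr _] := avoids321_fixed av uk.
    by have := lr i ik; rewrite uk; lia.
  have -> : cnt (A :&: F) y = cnt (A :&: F) x.
    apply: eq_card => k; rewrite !inE; case: (boolP (k \in F)) => kF; last by rewrite !andbF.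
    congr andb; apply/idP/idP => [ky|]; last by move/leq_trans; apply.
    by rewrite ltnNge; apply/negP => xk; have := nofix k kF (leq_trans ix xk); lia.
  have -> : cnt [set i : 'I_n | i < u i < y] n = cnt [set i : 'I_n | i < u i < y] x.
    apply: eq_card => k; rewrite !inE ltn_ord andbT; symmetry; apply: andb_idr.
    move=> /andP [kuk uky]; rewrite ltnNge; apply/negP => xk.
    by have := avoids321_gt av kuk (leq_trans ix xk); lia.
  have eqF : cnt F x = bal x.
    apply: bal_eq => // k kF; apply/eqP => kx.
    have := nofix k kF; have : i != k.
      by apply: contraTneq kF => <-; rewrite FE -val_eqE /=; lia.
    by rewrite -val_eqE /=; lia.
  by move: dec; rewrite eqF /bal; lia.
have rkx : rk u x y = x.
  apply: rk_eql => // i ix; rewrite ltnNge; apply: contra none => yui.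
  by apply/existsP; exists i; rewrite ix.
by move: dec; rewrite rkx /bal; lia.
Qed.

End Counts.

Lemma rk_counts u A B F x y : avoids321 u ->
    (forall i, (i \in F) = (u i == i)) ->
    (forall i, i \notin F -> (i \in A) = ((u^-1)%g i < i)) ->
    (forall i, i \notin F -> (i \in B) = (u i < i)) ->
    (forall x, x <= n -> cnt F x <= cnt (B :&: F) x + cnt (A :&: F) x) ->
    (forall x, x <= n -> {in F, forall k : 'I_n, k.+1 != x} ->
       cnt F x = cnt (B :&: F) x + cnt (A :&: F) x) ->
  x <= n -> y <= n -> rk u x y = minn (minn x y) (cnt B x + cnt A y).
Proof.
move=> av FE AE BE bal_ge bal_eq xn yn; case: (leqP x y) => xy; first exact: rk_half.
(* Inverting [u] swaps [x] with [y] and [A] with [B]. *)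
rewrite rkV addnC; apply: (rk_half (F := F)) (ltnW xy) xn.
- exact: avoids321V.
- by move=> i; rewrite FE -(inj_eq (@perm_inj _ u) (u^-1 i)%g) permKV eq_sym.
- by move=> i iF; rewrite invgK BE.
- by move=> i iF; rewrite AE.
- by move=> z zn; rewrite addnC bal_ge.
- by move=> z zn nz; rewrite addnC bal_eq.
Qed.

(** * Reading off the counts from a top rank function *)

Section TopRank.
Variables (u : 'S_n) (I : {set 'I_(n + n)}).
Hypothesis uE : forall x y, x <= n -> y <= n -> rk u x y = top_rank I x y.

Let h m := cnt (rightI I) m + cnt (leftI I) m.

(** The unit square from (i, i) to (i + 1, i + 1) holds no entry, whereas min(x, y) has mixed
    difference 1 on it; so the counts cannot exceed the diagonal at either corner. *)
Lemma top_rank_moved (i : 'I_n) : u i != i ->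
  [/\ (i \in rightI I) = (u i < i), (i \in leftI I) = ((u^-1)%g i < i),
      (i <= h i -> h i = i) & (i.+1 <= h i.+1 -> h i.+1 = i.+1)].
Proof.
move=> neq; have lti := ltn_ord i.
have : (u^-1)%g i != i by rewrite -(inj_eq (@perm_inj _ u)) permKV eq_sym.
move: neq; rewrite -!val_eqE /= /h.
have := rkSl u i i; have := rkSl u i i.+1.
have := rkS_nat u i i; have := rkS_nat u i.+1 i.
rewrite !uE ?(ltnW lti) // /top_rank !cntS.
by case: (i \in rightI I); case: (i \in leftI I) => *; split; lia.
Qed.

Lemma top_rank_fixed (i : 'I_n) : u i = i -> i <= h i /\ i.+1 <= h i.+1.
Proof.
move=> ui; have lti := ltn_ord i; have := top_rank_entry i uE.
have := rkSl u i i.+1; have := rkSr u i i.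
by rewrite ui /h !uE ?(ltnW lti) // /top_rank !cntS; lia.
Qed.

End TopRank.

(** Strong induction on x: a point outside [F] changes neither side, and a point of [F] lies in a
    maximal interval [s, t) with balance at s. The disjunction says that x does not cut a maximal
    interval in its interior. *)
Lemma bal_max_intervals F A B :
    (forall s t,
    itv n s t \in max_intervals F -> s < t -> t <= n ->
       (forall m, s <= m <= t -> m <= s + (cnt (B :&: itv n s t) m + cnt (A :&: itv n s t) m))
       /\ cnt (B :&: itv n s t) t + cnt (A :&: itv n s t) t = t - s) ->
  forall x, x <= n -> cnt F x <= cnt (B :&: F) x + cnt (A :&: F) x /\
    ({in F, forall k : 'I_n, k.+1 != x} \/ {in F, forall k : 'I_n, k != x :> nat} ->
     cnt F x = cnt (B :&: F) x + cnt (A :&: F) x).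
Proof.
move=> ballot; elim/ltn_ind => -[_ _|x IHx lex]; first by rewrite !cnt0.
pose k := Ordinal lex; have [kF|kF] := boolP (k \in F); last first.
  rewrite !(cntS _ k) !inE (negPf kF) !andbF !addn0.
  have [_ eqx] := IHx x (ltnSn x) (ltnW lex).
  suff -> : cnt F x = cnt (B :&: F) x + cnt (A :&: F) x by [].
  by apply: eqx; right => j jF; apply: contraNneq kF => jx; rewrite -(ord_inj (jx : j = k :> nat)).
have [K maxK kK] := max_intervals_cover kF.
have [s [t [/andP [st tn] defK KF sF tF]]] := max_intervals_itv maxK.
rewrite defK in maxK kK KF; have [le_m bal_t] := ballot s t maxK st tn.
move: kK; rewrite inE /= => /andP [sx xt].
have [_ eqs] := IHx s ltac:(lia) ltac:(lia); have eq_s := eqs (or_introl sF).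
have sxt : s <= x.+1 <= t by lia.
rewrite (cnt_itv F sxt) (cnt_itv (B :&: F) sxt) (cnt_itv (A :&: F) sxt).
rewrite -!setIA !(setIidPr KF) eq_s.
have -> : cnt (itv n s t) x.+1 = x.+1 - s.
  transitivity #|itv n s x.+1|; last by rewrite card_itv //; lia.
  by apply: eq_card => i; rewrite !inE; lia.
split; first by have := le_m x.+1 sxt; lia.
case=> [/(_ k kF)|nF]; first by rewrite eqxx.
have xt' : x.+1 = t.
  apply/eqP; rewrite eqn_leq xt leqNgt; apply/negP => lt.
  have lt' : x.+1 < n := leq_trans lt tn.
  have /nF : Ordinal lt' \in F by apply: (subsetP KF); rewrite inE /=; lia.
  by rewrite eqxx.
by rewrite xt'; lia.
Qed.

End Avoiding.

(** * The direct sum decomposition of the top sets *)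

Section Decomposition.
Variables (n : nat) (w : 'S_n).
Hypothesis avw : ~~ contains123 w.

Let wL := [set lshift n (w i) | i in Lset w].
Let nR := [set rshift n i | i in Rset w].
Let maxA := max_intervals (antifixed w).

Let max_fixed K : K \in maxA -> {in K, forall k, rv w k = k}.
Proof.
by move=> /max_intervals_itv [s [t [_ _ KF _ _]]] k /(subsetP KF); rewrite mem_antifixed => /eqP.
Qed.

Let calPK_sub K J : K \in maxA -> J \in calPK K -> J \subset Zset K.
Proof.
move=> /max_intervals_itv [s [t [/andP [st tn] -> _ _ _]]].
by move=> /(calPK_itv _ st tn) [].
Qed.

Lemma mem_wL a : (lshift n (rev_ord a) \in wL) = ((rv w)^-1%g a < a).
Proof.
apply/imsetP/idP => [[i]|lt].
  rewrite mem_Lset // => lt /lshift_inj e; have -> : a = rv w i by rewrite rvE -e rev_ordK.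
  by rewrite permK.
exists ((rv w)^-1%g a); first by rewrite mem_Lset // permKV.
by congr lshift; apply: rev_ord_inj; rewrite rev_ordK -rvE permKV.
Qed.

Lemma mem_nR b : (rshift n b \in nR) = (rv w b < b).
Proof. by rewrite mem_imset ?mem_Rset //; apply: rshift_inj. Qed.

Lemma mem_nR_l a : (lshift n a \in nR) = false.
Proof. by apply/imsetP => -[i _ /eqP]; rewrite eq_lrshift. Qed.

Lemma mem_wL_r b : (rshift n b \in wL) = false.
Proof. by apply/imsetP => -[i _ /eqP]; rewrite eq_rlshift. Qed.

Lemma wL_Zset K : K \in maxA -> [disjoint Zset K & wL].
Proof.
move=> maxK; apply/pred0P => c; apply/negbTE/andP => -[].
case: (split_ordP c) => [a ->|b ->] /=; last by rewrite mem_wL_r.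
rewrite -[a]rev_ordK mem_Zset_l mem_wL => /(max_fixed maxK) ua.
by rewrite -{1}ua permK ltnn.
Qed.

Lemma nR_Zset K : K \in maxA -> [disjoint Zset K & nR].
Proof.
move=> maxK; apply/pred0P => c; apply/negbTE/andP => -[].
case: (split_ordP c) => [a ->|b ->] /=; first by rewrite mem_nR_l.
by rewrite mem_Zset_r mem_nR => /(max_fixed maxK) ->; rewrite ltnn.
Qed.

Lemma Zset_disjoint K K' : K \in maxA -> K' \in maxA -> K != K' ->
  [disjoint Zset K & Zset K'].
Proof.
move=> mK mK' neq; apply/pred0P => c; apply/negbTE/andP => -[] /=.
case: (split_ordP c) => [a ->|b ->].
  rewrite -[a]rev_ordK !mem_Zset_l => aK aK'.
  by rewrite (max_intervals_eq mK mK' aK aK') eqxx in neq.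
by rewrite !mem_Zset_r => aK aK'; rewrite (max_intervals_eq mK mK' aK aK') eqxx in neq.
Qed.

Lemma decomposition_disjoint :
  disjoint_families ([seq calPK A | A : {set 'I_n} <- enum maxA] ++ [:: [set wL]; [set nR]]).
Proof.
rewrite /disjoint_families pairwise_cat pairwise_map; apply/and3P; split.
- apply/allrelP => _ G /mapP [K + ->]; rewrite mem_enum => maxK.
  rewrite !inE => /orP [] /eqP ->; apply/'forall_implyP => J JK;
    apply/'forall_implyP => X /set1P ->.
    by apply: disjointWl (wL_Zset maxK); apply: calPK_sub.
  by apply: disjointWl (nR_Zset maxK); apply: calPK_sub.
- have := enum_uniq maxA; rewrite uniq_pairwise.
  apply: (@sub_in_pairwise _ (mem maxA)); last by apply/allP => K; rewrite mem_enum.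
  move=> K K' mK mK' /= neq.
  apply/'forall_implyP => J JK; apply/'forall_implyP => J' JK'.
  apply: disjointWl (calPK_sub mK JK) _; apply: disjointWr (calPK_sub mK' JK') _.
  exact: Zset_disjoint.
- rewrite /= !andbT; apply/'forall_implyP => X /set1P ->; apply/'forall_implyP => Y /set1P ->.
  apply/pred0P => c; apply/negbTE/andP => -[] /=.
  by case: (split_ordP c) => [a ->|b ->]; rewrite ?mem_nR_l ?mem_wL_r.
Qed.

Lemma calQ_sub_decomposition I : I \in calQ w ->
  I \in (\bigoplus_(A in maxA) calPK A) \oplus [set wL] \oplus [set nR].
Proof.
move=> /calQ_rank [cardI uE]; have av := avoids123_rv avw.
have nF i : rv w i != i ->
    (i \in rightI I) = (rv w i < i) /\ (i \in leftI I) = ((rv w)^-1%g i < i).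
  by case/(top_rank_moved uE).
(* Over moved points, membership in [I] is dictated by [rv w]; the remaining elements are sorted by
   the maximal interval they come from. *)
have defI : I = \bigcup_(K in maxA) (I :&: Zset K) :|: wL :|: nR.
  apply/setP => c; rewrite !in_setU -orbA; apply/idP/idP => [cI|].
    case: (split_ordP c) cI => [a ->|b ->] cI.
      rewrite -[a]rev_ordK in cI *; move: (rev_ord a) cI => {}a aI.
      have [ua|ua] := boolP (a \in antifixed w).
        have [K mK aK] := max_intervals_cover ua.
        by apply/orP; left; apply/bigcupP; exists K; rewrite // inE aI mem_Zset_l.
      rewrite mem_antifixed in ua; have [_ aE] := nF a ua.
      by rewrite mem_wL -aE inE aI orbT.
    have [ub|ub] := boolP (b \in antifixed w).
      have [K mK bK] := max_intervals_cover ub.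
      by apply/orP; left; apply/bigcupP; exists K; rewrite // inE cI mem_Zset_r.
    rewrite mem_antifixed in ub; have [bE _] := nF b ub.
    by rewrite mem_nR -bE inE cI !orbT.
  case/orP => [/bigcupP [K _ /setIP []//]|].
  case: (split_ordP c) => [a ->|b ->].
    rewrite mem_nR_l orbF -[a]rev_ordK mem_wL => lt.
    have ua : rv w (rev_ord a) != rev_ord a.
      by apply: contraL lt => /eqP ua; rewrite -{1}ua permK ltnn.
    by have [_] := nF _ ua; rewrite lt inE => ->.
  rewrite mem_wL_r mem_nR /= => lt.
  have ub : rv w b != b by apply: contraL lt => /eqP ->; rewrite ltnn.
  by have [+ _] := nF _ ub; rewrite lt inE => ->.
rewrite {1}defI; apply: imset2_f; last exact: set11.
apply: imset2_f; last exact: set11.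
apply/mem_bigoplus; exists (fun K => I :&: Zset K) => // K maxK.
have [s [t [/andP [st tn] defK KF sF tF]]] := max_intervals_itv maxK.
rewrite defK in KF *.
have K_fixed (k : 'I_n) : s <= k < t -> rv w k = k.
  by move=> kst; apply/eqP; rewrite -mem_antifixed (subsetP KF) ?inE.
pose h m := cnt (rightI I) m + cnt (leftI I) m.
(* For s > 0, the moved point s - 1 bounds [h s] above and the fixed point s bounds it below. *)
have hs : h s = s.
  case: s st sF {defK KF} K_fixed => [|s] st sF K_fixed; first by rewrite /h !cnt0.
  have lts : s < n := ltnW (leq_trans st tn).
  have lts' : s.+1 < n := leq_trans st tn.
  have ns : rv w (Ordinal lts) != Ordinal lts.
    by rewrite -mem_antifixed; apply/negP => /sF; rewrite eqxx.
  have [_ _ _] := top_rank_moved uE ns; apply.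
  have fs : rv w (Ordinal lts') = Ordinal lts' by apply: K_fixed; rewrite /= leqnn.
  by have [] := top_rank_fixed uE fs.
(* At t = n this is |I| = n; otherwise the moved point t and the fixed point t - 1 give the two
   bounds. *)
have ht : h t = t.
  have [t_eq|t_neq] := eqVneq t n.
    by rewrite /h t_eq !cnt_full -card_leftI_rightI.
  have ltt : t < n by rewrite ltn_neqAle t_neq.
  have nt : rv w (Ordinal ltt) != Ordinal ltt.
    by rewrite -mem_antifixed; apply/negP => /tF; rewrite eqxx.
  have [_ _ + _] := top_rank_moved uE nt; apply.
  have ltp : t.-1 < n by lia.
  have fp : rv w (Ordinal ltp) = Ordinal ltp by apply: K_fixed => /=; lia.
  by have [_] := top_rank_fixed uE fp; rewrite /= prednK //; lia.
have hm m : s <= m <= t -> m <= h m.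
  move=> smt; have [->|mt] := eqVneq m t; first by rewrite ht.
  have ltm : m < n by lia.
  have fm : rv w (Ordinal ltm) = Ordinal ltm by apply: K_fixed => /=; lia.
  by have [] := top_rank_fixed uE fm.
have RE : rightI (I :&: Zset (itv n s t)) = rightI I :&: itv n s t.
  by apply/setP => b; rewrite !(in_setI, inE) -in_setU mem_Zset_r inE.
have LE : leftI (I :&: Zset (itv n s t)) = leftI I :&: itv n s t.
  by apply/setP => b; rewrite !(in_setI, inE) -in_setU mem_Zset_l inE.
apply/(calPK_itv _ st tn); rewrite RE LE; split; first exact: subsetIr.
  have stt : s <= t <= t by rewrite (ltnW st) /=.
  by move: ht hs; rewrite /h (cnt_itv (rightI I) stt) (cnt_itv (leftI I) stt); lia.
by move=> m smt; move: (hm m smt) hs; rewrite /h (cnt_itv (rightI I) smt) (cnt_itv (leftI I) smt); lia.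
Qed.

Lemma decomposition_sub_calQ I :
  I \in (\bigoplus_(A in maxA) calPK A) \oplus [set wL] \oplus [set nR] ->
  I \in calQ w.
Proof.
case/imset2P => Y Z /imset2P [X W /mem_bigoplus [f fP ->]] /set1P -> -> /set1P -> defI.
have av := avoids123_rv avw.
(* The summands have disjoint supports, so inside [Zset K] only [f K] contributes. *)
have mem_piece K c : K \in maxA -> c \in Zset K -> (c \in I) = (c \in f K).
  move=> maxK cK; rewrite defI !in_setU; apply/idP/idP; last first.
    by move=> cf; apply/orP; left; apply/orP; left; apply/bigcupP; exists K.
  have /pred0P /(_ c) /= := wL_Zset maxK; rewrite cK /= => ->.
  have /pred0P /(_ c) /= := nR_Zset maxK; rewrite cK /= => ->.
  rewrite !orbF => /bigcupP [K' maxK' cf]; have [<-//|neq] := eqVneq K' K.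
  have /pred0P /(_ c) /= := Zset_disjoint maxK' maxK neq.
  by rewrite cK (subsetP (calPK_sub maxK' (fP _ maxK')) _ cf).
have notf c : (forall K, K \in maxA -> c \notin Zset K) ->
    (c \in I) = (c \in wL) || (c \in nR).
  move=> ncK; rewrite defI !in_setU -orbA; case: bigcupP => // -[K' maxK' cf].
  by have := ncK K' maxK'; rewrite (subsetP (calPK_sub maxK' (fP _ maxK')) _ cf).
have FE i : (i \in antifixed w) = (rv w i == i) := mem_antifixed w i.
have notK i : i \notin antifixed w -> forall K, K \in maxA -> i \notin K.
  by move=> iF K /max_fixed fixK; apply: contra iF => /fixK; rewrite FE => ->.
have AE i : i \notin antifixed w -> (i \in leftI I) = ((rv w)^-1%g i < i).
  move=> /notK iF; rewrite inE notf ?mem_wL ?mem_nR_l ?orbF //.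
  by move=> K maxK; rewrite mem_Zset_l iF.
have BE i : i \notin antifixed w -> (i \in rightI I) = (rv w i < i).
  move=> /notK iF; rewrite inE notf ?mem_nR ?mem_wL_r //.
  by move=> K maxK; rewrite mem_Zset_r iF.
have /bal_max_intervals bal : forall s t,
    itv n s t \in maxA -> s < t -> t <= n ->
    (forall m, s <= m <= t ->
       m <= s + (cnt (rightI I :&: itv n s t) m + cnt (leftI I :&: itv n s t) m))
    /\ cnt (rightI I :&: itv n s t) t + cnt (leftI I :&: itv n s t) t = t - s.
  move=> s t maxK st tn; have fKK := fP _ maxK.
  have [JZ bal_t ballot] := (calPK_itv _ st tn).1 fKK.
  have -> : rightI I :&: itv n s t = rightI (f (itv n s t)).
    apply/setP => b; rewrite in_setI !(in_set (fun b => rshift n b \in _)).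
    have [bK|bK] := boolP (b \in itv n s t).
      by rewrite andbT (mem_piece _ _ maxK) // mem_Zset_r.
    by rewrite andbF; symmetry; apply: contraNF bK => /(subsetP JZ); rewrite mem_Zset_r.
  have -> : leftI I :&: itv n s t = leftI (f (itv n s t)).
    apply/setP => b; rewrite in_setI !(in_set (fun b => lshift n (rev_ord b) \in _)).
    have [bK|bK] := boolP (b \in itv n s t).
      by rewrite andbT (mem_piece _ _ maxK) // mem_Zset_l.
    by rewrite andbF; symmetry; apply: contraNF bK => /(subsetP JZ); rewrite mem_Zset_l.
  by [].
have rkE x y : x <= n -> y <= n ->
    rk (rv w) x y = minn (minn x y) (cnt (rightI I) x + cnt (leftI I) y).
  apply: (rk_counts av FE AE BE) => z zn; first by case: (bal z zn).
  by move=> nz; apply: (bal z zn).2; left.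
apply/calQ_rank; split; last exact: rkE.
(* For |I| = n, the rank n at (n, n), split by [rk_decomp], is compared with the two counts, using
   the balance at n. *)
have [_ bal_n] := bal n (leqnn n).
have eq_n : cnt (antifixed w) n = _ := bal_n (or_intror _).
have := rk_decomp FE (leqnn n) (leqnn n).
rewrite rk_fulll // eq_n => [|k _]; last by rewrite neq_ltn ltn_ord.
have := cntA FE AE n; have := cntB FE BE n.
by rewrite card_leftI_rightI !cnt_full; lia.
Qed.

End Decomposition.

Theorem theorem3p3 (n : nat) (n_gt0 : 0 < n) :
  [/\ forall v w : 'S_n, bruhat_le v w -> calP w \subset calP v,
      forall v w : 'S_n, v != w -> [disjoint calQ v & calQ w],
      forall w : 'S_n, contains123 w -> calQ w = set0
    & forall w : 'S_n, ~~ contains123 w ->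
        let wL := [set lshift n (w i) | i in Lset w] in
        let nR := [set rshift n i | i in Rset w] in
        let maxA := max_intervals (antifixed w) in
        disjoint_families
          ([seq calPK A | A : {set 'I_n} <- enum maxA]
             ++ [:: [set wL]; [set nR]])
        /\ calQ w = (\bigoplus_(A in maxA) calPK A) \oplus [set wL] \oplus [set nR]].
Proof.
split.
- exact: calP_anti.
- exact: calQ_disjoint.
- exact: calQ_contains123.
move=> w avw wL nR maxA; split; first exact: decomposition_disjoint.
apply/setP => I; apply/idP/idP; first exact: calQ_sub_decomposition.
exact: decomposition_sub_calQ.
Qed.
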